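(* Let $r_n$ be the number of reduced tree pairs with $n$ carets in each tree. Then $$r_n\sim A\,\frac{\mu^n}{n^3},$$ where $\mu=8+4\sqrt{3}$ and $A>0$ is a constant.
   Context: A caret is a pair of edges joining two vertices to a common parent. A finite rooted binary tree with $n$ carets (i.e. $n$ internal nodes) has $n+1$ leaves, numbered from left to right. An $n$-caret tree pair is an ordered pair of rooted binary trees each having $n$ carets. An exposed caret is a caret both of whose children are leaves. A tree pair with at least two carets in each tree is unreduced if, for some $k$, both trees contain an exposed caret with leaves numbered $k$ and $k+1$; otherwise it is reduced (in particular the pair of single carets is reduced). $r_n$ denotes the number of reduced tree pairs with $n$ carets in each tree, with $r_0=0$ and $r_1=1$. The notation $f(n)\sim g(n)$ means $\lim_{n\to\infty} f(n)/g(n)=1$. *)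

(* Defs.v *)
From HB Require Import structures.
From mathcomp Require Import all_boot all_order all_algebra.
From mathcomp Require Import all_classical all_reals all_analysis.

Set Implicit Arguments.
Unset Strict Implicit.
Unset Printing Implicit Defensive.

Import Order.TTheory GRing.Theory Num.Theory.
Import numFieldNormedType.Exports.

Inductive bintree : Type := Leaf | Caret of bintree & bintree.

Fixpoint ncarets (t : bintree) : nat :=
  if t is Caret l r then (ncarets l + ncarets r).+1 else 0.

Fixpoint nleaves (t : bintree) : nat :=
  if t is Caret l r then nleaves l + nleaves r else 1.

(* The list of all k such that the leaves numbered k and k+1 form an exposed
   caret; leaves are numbered from left to right, starting from 0. *)
Fixpoint exposed_carets (t : bintree) : seq nat :=
  match t with
  | Leaf => [::]
  | Caret Leaf Leaf => [:: 0]
  | Caret l r => exposed_carets l ++ map (addn (nleaves l)) (exposed_carets r)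
  end.

Fixpoint bintree_encode (t : bintree) : GenTree.tree unit :=
  if t is Caret l r then GenTree.Node 0 [:: bintree_encode l; bintree_encode r]
  else GenTree.Leaf tt.

Fixpoint bintree_decode (u : GenTree.tree unit) : bintree :=
  if u is GenTree.Node 0 [:: l; r] then Caret (bintree_decode l) (bintree_decode r)
  else Leaf.

Lemma bintree_encodeK : cancel bintree_encode bintree_decode.
Proof. by elim=> [|l IHl r IHr] //=; rewrite IHl IHr. Qed.

HB.instance Definition _ := Countable.copy bintree (can_type bintree_encodeK).

(* All binary trees of height at most h. *)
Fixpoint bintrees_upto (h : nat) : seq bintree :=
  if h is h'.+1 then
    Leaf :: [seq Caret l r | l <- bintrees_upto h', r <- bintrees_upto h']
  else [:: Leaf].

Lemma bintrees_upto_uniq h : uniq (bintrees_upto h).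
Proof.
elim: h => [|h IHh] //=; apply/andP; split.
  by apply/negP => /allpairsP[[l r] []].
by apply: allpairs_uniq => // -[l r] [l' r'] _ _ [-> ->].
Qed.

Lemma mem_bintrees_upto h t : ncarets t <= h -> t \in bintrees_upto h.
Proof.
elim: h t => [|h IHh] [|l r] //=; rewrite ltnS => le_h.
rewrite inE /=; apply/allpairsP; exists (l, r); split=> //=; apply: IHh.
  exact: leq_trans (leq_addr _ _) le_h.
exact: leq_trans (leq_addl _ _) le_h.
Qed.

Record bintree_of (n : nat) : Type :=
  BintreeOf { tree :> bintree; _ : ncarets tree == n }.

HB.instance Definition _ n := [isSub for @tree n].
HB.instance Definition _ n := [Countable of bintree_of n by <:].

Definition bintree_of_enum n : seq (bintree_of n) :=
  pmap insub (bintrees_upto n).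

Lemma bintree_of_enumP n : Finite.axiom (bintree_of_enum n).
Proof.
apply: Finite.uniq_enumP; first exact/pmap_sub_uniq/bintrees_upto_uniq.
move=> t; rewrite mem_pmap_sub.
by apply: mem_bintrees_upto; rewrite (eqP (valP t)).
Qed.

HB.instance Definition _ n :=
  fintype.isFinite.Build (bintree_of n) (@bintree_of_enumP n).

Definition unreduced n (p : bintree_of n * bintree_of n) : bool :=
  (2 <= n) && has (fun k => k \in exposed_carets p.2) (exposed_carets p.1).

Definition reduced n (p : bintree_of n * bintree_of n) : bool :=
  ~~ unreduced p.

(* A tree pair has at least one caret in each tree, so the pair of trivial
   trees is not counted. *)
Definition nreduced (n : nat) : nat :=
  if n == 0 then 0
  else #|[pred p : bintree_of n * bintree_of n | reduced p]|.

Lemma nreduced0 : nreduced 0 = 0.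
Proof. by []. Qed.

Lemma nreduced1 : nreduced 1 = 1.
Proof.
pose c : bintree_of 1 := @BintreeOf 1 (Caret Leaf Leaf) erefl.
have u (t : bintree_of 1) : t = c.
  by apply: val_inj; case: t => -[|[|? ?] [|? ?]] //=; rewrite ?addnS.
rewrite /nreduced /= -[RHS](card1 (c, c)).
by apply: eq_card => -[t s]; rewrite !inE (u t) (u s) eqxx.
Qed.

Local Open Scope classical_set_scope.
Local Open Scope ring_scope.

Definition asymp_equiv (R : realType) (f g : nat -> R) : Prop :=
  f n / g n @[n --> \oo] --> (1 : R).

(* Main.v *)
Require Import Defs.
From mathcomp Require Import all_boot all_order all_algebra.
From mathcomp Require Import all_classical all_reals all_analysis.
From mathcomp Require Import zify ring lra.
Import Order.TTheory GRing.Theory Num.Theory.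
Import numFieldNormedType.Exports.

(** Write C_n for the Catalan numbers, r_n for the number of reduced pairs and
    mu = 8 + 4 sqrt 3.

    Combinatorics.  Let A(n, k) count the pairs of trees with n carets that have
    no common exposed caret at a position below k.  Collapsing a common exposed
    caret at position k in both trees gives
    A(n+1, k) = A(n+1, k+1) + A(n, k-1) (ndisjointS), while A(n, 0) = C_n^2 and
    A(n, n) = r_n for n > 1.  So if C_m^2 is the m-th moment of a measure on
    [0, 16], then r_n is the integral of the polynomial p_n (reduced_poly) with
    p_0 = 1, p_1 = x - 1 and p_(n+2) = x (p_(n+1) - p_n).  Passing to an integral
    is what makes the asymptotics accessible: the expansion of r_n in the
    numbers C_m^2 is an alternating sum with exponentially large cancellations,
    whereas p_n behaves well as a function of x.  No integration is needed: for
    any M, equally spaced angles give a finite positive measure whose moments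
    are C_m^2 for all m <= M (catalan_sqr_quadrature), and n is fixed when M is
    chosen.

    Asymptotics of p_n.  For x <= 13 one has |p_n(x)| <= 14^n, negligible
    against mu^n since mu > 14.  For x between 13 and 16, p_n(x) is close to
    G(t) t^n, where t is the larger root of t^2 = x (t - 1) and
    G(t) = 1 + 1 / (t (t - 2)); at x = 16 this root is mu.  With y = x / 16, the
    ratio t / mu agrees with y^lam up to a factor exp (-O((1 - y)^2)), where
    lam = (mu - 1) / (mu - 2) is the value of d ln t / d ln x at x = 16.
    Hence, m being the integer part of lam n, p_n(x) / mu^n equals G(mu) y^m up
    to O((1 - y) + n (1 - y)^2) y^m and an exponentially small term
    (reduced_poly_approx).

    Conclusion.  Integrating, r_n / mu^n differs from G(mu) v_m, where
    v_m = C_m^2 / 16^m, by first and second differences of v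
    (nreduced_approx).  Now m^3 v_m has a positive limit c (scaled_moment_cvg),
    and those differences are smaller than v_m by factors O(1/m) and O(1/m^2);
    so n^3 r_n / mu^n tends to G(mu) c / lam^3. *)

(** * Collapsing common exposed carets *)

Local Open Scope nat_scope.

Lemma nleavesE t : nleaves t = (ncarets t).+1.
Proof. by elim: t => //= l -> r ->; rewrite addSn addnS. Qed.

Lemma exposed_bound t i : i \in exposed_carets t -> i.+1 < nleaves t.
Proof.
elim: t i => [//|l IHl r IHr] i.
have branch : i \in exposed_carets l ++ map (addn (nleaves l)) (exposed_carets r)
    -> i.+1 < nleaves l + nleaves r.
  rewrite mem_cat => /orP[/IHl|/mapP[j /IHr jr ->]]; first by lia.
  by rewrite -addnS ltn_add2l.
case: l r {IHl IHr} branch => [|l1 l2] [|r1 r2] //= _.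
by rewrite inE => /eqP->.
Qed.

(** Case analysis by position; the last leaf of l (position nleaves l - 1) is
    covered by the first branch, where it is never exposed. *)
Lemma mem_exposed l r i :
  (i \in exposed_carets (Caret l r)) =
    if (l == Leaf) && (r == Leaf) then i == 0
    else if i < nleaves l then i \in exposed_carets l
    else i - nleaves l \in exposed_carets r.
Proof.
have branch : (i \in exposed_carets l ++ map (addn (nleaves l)) (exposed_carets r)) =
    if i < nleaves l then i \in exposed_carets l
    else i - nleaves l \in exposed_carets r.
  rewrite mem_cat; case: ltnP => [il|li].
    rewrite orbC; case: mapP => [[j _ ij]|//]; lia.
  rewrite [X in X || _]negbTE ?orFb; last first.
    by apply/negP => /exposed_bound; lia.
  by rewrite -{1}(subnKC li) mem_map //; exact: addnI.
by case: l r branch => [|l1 l2] [|r1 r2] //= _; rewrite inE.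
Qed.

Fixpoint expand (t : bintree) (k : nat) : bintree :=
  if t is Caret l r then
    if k < nleaves l then Caret (expand l k) r
    else Caret l (expand r (k - nleaves l))
  else Caret Leaf Leaf.

Fixpoint collapse (t : bintree) (k : nat) : bintree :=
  match t with
  | Leaf | Caret Leaf Leaf => Leaf
  | Caret l r =>
      if k < nleaves l then Caret (collapse l k) r
      else Caret l (collapse r (k - nleaves l))
  end.

Lemma ncarets_expand t k : ncarets (expand t k) = (ncarets t).+1.
Proof.
elim: t k => [//|l IHl r IHr] k /=.
by case: ifP => _ /=; rewrite ?IHl ?IHr ?addSn ?addnS.
Qed.

Lemma expand_neq_Leaf t k : (expand t k == Leaf) = false.
Proof. by apply/negP => /eqP eqL; have := ncarets_expand t k; rewrite eqL. Qed.

Lemma collapse_Caret l r k : ~~ ((l == Leaf) && (r == Leaf)) ->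
  collapse (Caret l r) k =
    if k < nleaves l then Caret (collapse l k) r
    else Caret l (collapse r (k - nleaves l)).
Proof. by case: l r => [|? ?] [|? ?]. Qed.

Lemma expandK k : cancel (expand^~ k) (collapse^~ k).
Proof.
move=> t; elim: t k => [//|l IHl r IHr] k /=.
case: ltnP => kl; rewrite collapse_Caret ?expand_neq_Leaf ?andbF //.
  by rewrite nleavesE ncarets_expand ltnS -nleavesE ltnW // IHl.
by rewrite ltnNge kl /= IHr.
Qed.

Lemma collapseK t k : k \in exposed_carets t -> expand (collapse t k) k = t.
Proof.
elim: t k => [//|l IHl r IHr] k; rewrite mem_exposed.
case: ifPn => [/andP[/eqP-> /eqP->] //|nLL].
rewrite collapse_Caret //; case: ltnP => [kl k_l|lk k_r] /=.
  have cl : nleaves l = (nleaves (collapse l k)).+1.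
    by rewrite -[in LHS](IHl k k_l) !nleavesE ncarets_expand.
  by have := exposed_bound _ _ k_l; rewrite cl ltnS => ->; rewrite IHl.
by rewrite ltnNge lk /= IHr.
Qed.

Lemma expand_exposed t k : k < nleaves t -> k \in exposed_carets (expand t k).
Proof.
elim: t k => [|l IHl r IHr] k /=; first by case: k.
move=> klr; case: ltnP => kl; rewrite mem_exposed expand_neq_Leaf ?andbF /=.
  by rewrite nleavesE ncarets_expand ltnS -nleavesE ltnW // IHl.
by rewrite ltnNge kl /= IHr //; lia.
Qed.

(** Position k-1 is never exposed after expanding leaf k, because leaf k then
    belongs to the exposed caret k; this is what makes the index drop from k to
    k-1 in the recurrence below. *)
Lemma mem_exposed_expand t k i : k < nleaves t -> i < k ->
  (i \in exposed_carets (expand t k)) =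
    (i < k.-1) && (i \in exposed_carets t).
Proof.
elim: t k i => [|l IHl r IHr] k i /=; first by case: k.
move=> klr ik; case: ltnP => kl; rewrite !mem_exposed expand_neq_Leaf ?andbF /=.
  rewrite nleavesE ncarets_expand ltnS -nleavesE.
  have il := ltn_trans ik kl; rewrite (ltnW il) IHl // il.
  by case: ifP => // /andP[/eqP lL _]; move: kl ik; rewrite lL /=; case: (k).
case: ltnP => il; last first.
  rewrite IHr; [|lia|lia].
  case: ifPn => [/andP[/eqP lL /eqP rL]|_]; last by congr andb; lia.
  by move: klr kl ik il; rewrite lL rL /= => *; exfalso; lia.
case: ifPn => [/andP[/eqP lL /eqP rL]|_].
  by move: klr; rewrite lL rL /=; case: (k) => [|[|]].
by case: (boolP (i \in _)) => [/exposed_bound|]; rewrite ?andbF //; lia.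
Qed.

Definition disjoint_below (k : nat) (t s : bintree) : bool :=
  [forall i : 'I_k, ~~ ((val i \in exposed_carets t) && (val i \in exposed_carets s))].

Definition ndisjoint (n k : nat) : nat :=
  #|[set p : bintree_of n * bintree_of n | disjoint_below k p.1 p.2]|.

Lemma expand_subproof n k (t : bintree_of n) : ncarets (expand t k) == n.+1.
Proof. by rewrite ncarets_expand (eqP (valP t)). Qed.

Definition expand_of n k (t : bintree_of n) : bintree_of n.+1 :=
  BintreeOf (expand_subproof n k t).

Lemma expand_of_inj n k : injective (@expand_of n k).
Proof. by move=> s t /(congr1 val)/(can_inj (expandK k))/val_inj. Qed.

Lemma disjoint_belowS k t s : disjoint_below k.+1 t s =
  disjoint_below k t s && ~~ ((k \in exposed_carets t) && (k \in exposed_carets s)).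
Proof.
apply/forallP/andP => [H|[/forallP H Hk] i].
  split; last by have := H ord_max.
  by apply/forallP => i; have := H (widen_ord (leqnSn k) i).
case: (ltngtP i k) => [ik|ki|ik]; first exact: (H (Ordinal ik)).
  by have := ltn_ord i; rewrite ltnS leqNgt ki.
by rewrite /= ik.
Qed.

Lemma disjoint_below_expand k t s : k < nleaves t -> k < nleaves s ->
  disjoint_below k (expand t k) (expand s k) = disjoint_below k.-1 t s.
Proof.
move=> kt ks; apply/forallP/forallP => H i.
  have ik : i < k by have := ltn_ord i; lia.
  by have := H (Ordinal ik); rewrite /= !mem_exposed_expand //= ltn_ord.
rewrite !mem_exposed_expand ?ltn_ord //.
case: ltnP => //= ik; exact: (H (Ordinal ik)).
Qed.

(** The pairs with no common exposed caret below k split according to whether k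
    itself is a common exposed caret.  Collapsing that caret in both trees maps
    the second kind bijectively to pairs of trees with n carets, and as position
    k-1 of the larger trees is then automatically unexposed, only the positions
    below k-1 remain constrained.  For k = 0 the predecessor is 0, which is
    right: nothing is constrained on either side. *)
Lemma ndisjointS n k : k <= n ->
  ndisjoint n.+1 k = ndisjoint n.+1 k.+1 + ndisjoint n k.-1.
Proof.
move=> kn; rewrite /ndisjoint.
pose common := [set p : bintree_of n.+1 * bintree_of n.+1 |
  (k \in exposed_carets p.1) && (k \in exposed_carets p.2)].
rewrite -(cardsID common) addnC; congr addn.
  by apply: eq_card => p; rewrite !inE disjoint_belowS andbC.
pose f (p : bintree_of n * bintree_of n) := (expand_of n k p.1, expand_of n k p.2).
have f_inj : injective f.
  by move=> [s t] [s' t'] [es et]; congr pair; apply: (expand_of_inj n k); exact: val_inj.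
have kl (t : bintree_of n) : k < nleaves t by rewrite nleavesE (eqP (valP t)).
rewrite -(card_imset _ f_inj); apply: eq_card => -[t s].
rewrite !inE /=; apply/idP/imsetP => [/andP[disj /andP[kt ks]]|[[t' s']]].
  have sub (u : bintree_of n.+1) : k \in exposed_carets u -> ncarets (collapse u k) == n.
    by move=> ku; rewrite -eqSS -(ncarets_expand _ k) collapseK // (valP u).
  exists (BintreeOf (sub t kt), BintreeOf (sub s ks)); last first.
    by congr pair; apply: val_inj; rewrite /= collapseK.
  rewrite inE /= -disjoint_below_expand ?collapseK //.
    exact: (kl (BintreeOf (sub t kt))).
  exact: (kl (BintreeOf (sub s ks))).
rewrite inE /= => disj [-> ->] /=.
by rewrite disjoint_below_expand // disj !expand_exposed.
Qed.

Lemma ndisjoint0 n : ndisjoint n 0 = #|{: bintree_of n}| ^ 2.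
Proof.
rewrite /ndisjoint expnS expn1 -card_prod; apply: eq_card => p.
by rewrite !inE; apply/forallP => -[].
Qed.

Lemma nreducedE n : 1 < n -> nreduced n = ndisjoint n n.
Proof.
case: n => [//|n] n1; rewrite /nreduced /ndisjoint.
apply: eq_card => -[t s]; rewrite !inE /reduced /unreduced n1 /=.
apply/hasPn/forallP => [H i|H i it].
  by apply/negP => /andP[it]; apply/negP/H.
have ilt : i < n.+1 by have := exposed_bound _ _ it; rewrite nleavesE (eqP (valP t)).
by have := H (Ordinal ilt); rewrite /= it.
Qed.

(** * Catalan numbers *)

Definition catalan (n : nat) : nat := #|{: bintree_of n}|.

Lemma catalan0 : catalan 0 = 1.
Proof.
rewrite /catalan -(card1 (@BintreeOf 0 Leaf isT)); apply: eq_card => t.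
by rewrite !inE; apply/esym/eqP/val_inj; case: t => -[].
Qed.

Lemma Caret_subproof n (i : 'I_n.+1) (l : bintree_of i) (r : bintree_of (n - i)) :
  ncarets (Caret l r) == n.+1.
Proof.
by rewrite /= (eqP (valP l)) (eqP (valP r)) subnKC // -ltnS ltn_ord.
Qed.

Lemma catalanS n : catalan n.+1 = \sum_(i < n.+1) catalan i * catalan (n - i).
Proof.
pose S := {i : 'I_n.+1 & (bintree_of i * bintree_of (n - i))%type}.
pose f (u : S) : bintree_of n.+1 :=
  let: existT i (l, r) := u in BintreeOf (Caret_subproof n i l r).
have f_inj : injective f.
  move=> [i [l r]] [j [l' r']] /(congr1 val) /= [].
  case: l r l' r' => [l li] [r ri] [l' lj] [r' rj] /= ll rr.
  subst l' r'.
  have ij : i = j by apply: val_inj; rewrite /= -(eqP li) (eqP lj).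
  subst j; congr existT; congr pair; exact: val_inj.
have -> : catalan n.+1 = #|{: S}|.
  rewrite -cardsT -(card_imset _ f_inj); apply: eq_card => t; rewrite !inE.
  apply/esym/imsetP; case: t => -[//|l r] t_n.
  have li : ncarets l < n.+1 by move: (t_n); rewrite /= => /eqP[<-]; lia.
  have ri : ncarets r == n - Ordinal li by move: (t_n); rewrite /=; lia.
  exists (existT _ (Ordinal li) (@BintreeOf _ l (eqxx _), @BintreeOf _ r ri)) => //.
  exact: val_inj.
rewrite card_tagged sumnE big_map big_enum /=.
by apply: eq_bigr => i _; rewrite card_prod.
Qed.

(** Symmetrisation i <-> n - i: an affine weight on the Catalan convolution can
    be replaced by its average. *)
Lemma catalan_sum_affine n a b :
  2 * \sum_(i < n.+1) (a * i + b) * (catalan i * catalan (n - i)) =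
    (a * n + 2 * b) * catalan n.+1.
Proof.
rewrite mul2n -addnn [X in X + _](reindex_inj rev_ord_inj) -big_split catalanS.
rewrite big_distrr /=; apply: eq_bigr => i _.
have iltn := ltn_ord i.
rewrite subSS subKn // [catalan (n - i) * _]mulnC -mulnDl; congr (_ * _).
by rewrite addnACA -mulnDr subnK // mul2n addnn.
Qed.

(** The weight i+1 turns the convolution of order n+1 into one of order n, by
    the recurrence for smaller indices; both sums are then evaluated by
    symmetrisation. *)
Lemma catalan_rec n : n.+2 * catalan n.+1 = (4 * n + 2) * catalan n.
Proof.
elim/ltn_ind: n => n IHn.
have twice : (n + 2) * catalan n.+1 = 2 * ((2 * n + 1) * catalan n).
  have := catalan_sum_affine n 1 1; rewrite mul1n muln1 => <-; congr (2 * _).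
  rewrite big_ord_recl /= catalan0 subn0 mul1n.
  case: n IHn => [|n] IHn; first by rewrite big_ord0 catalan0.
  have -> : \sum_(i < n.+1) (1 * bump 0 i + 1) *
      (catalan (bump 0 i) * catalan (n.+1 - bump 0 i)) =
    \sum_(i < n.+1) (4 * i + 2) * (catalan i * catalan (n - i)).
    apply: eq_bigr => i _; rewrite /bump /= add1n subSS mul1n addn1.
    by rewrite mulnA IHn ?mulnA //; have := ltn_ord i; lia.
  have := catalan_sum_affine n 4 2; lia.
by rewrite -addn2 twice; lia.
Qed.

Lemma catalan_bin n : n.+1 * catalan n = 'C(n.*2, n).
Proof.
elim: n => [|n IHn]; first by rewrite catalan0.
have b1 : n.+1 * 'C(n.+1.*2, n.+1) = n.+1.*2 * 'C(n.*2.+1, n).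
  by rewrite doubleS -mul_bin_diag.
have b2 : n.+1 * 'C(n.*2.+1, n) = n.*2.+1 * 'C(n.*2, n).
  have := mul_bin_down n.*2.+1 n; rewrite /= => ->; congr (_ * _); lia.
have cr := catalan_rec n.
apply/eqP; rewrite -(eqn_pmul2l (ltn0Sn n)) -(eqn_pmul2l (ltn0Sn n)); apply/eqP.
nia.
Qed.

(** * Finite measures with Catalan moments *)

Local Open Scope ring_scope.

(** The binomial expansion of (e^(i th) + e^(-i th))^k, written with real
    cosines; the extra angle phi makes the induction on k go through. *)
Lemma cos_power_sum (R : realType) k (phi th : R) :
  (2 * cos th) ^+ k * cos phi =
    \sum_(i < k.+1) 'C(k, i)%:R * cos (phi + (k%:R - i%:R *+ 2) * th).
Proof.
elim: k phi => [|k IHk] phi.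
  by rewrite big_ord1 /= bin0 mulr0n mul0rn subr0 mul0r addr0 expr0.
have -> : (2 * cos th) ^+ k.+1 * cos phi =
    (2 * cos th) ^+ k * cos (phi + th) + (2 * cos th) ^+ k * cos (phi - th).
  by rewrite cosD cosB exprS; ring.
rewrite !IHk [RHS]big_ord_recl.
have -> : \sum_(i < k.+1) 'C(k.+1, lift ord0 i)%:R *
      cos (phi + (k.+1%:R - (lift ord0 i)%:R *+ 2) * th) =
    \sum_(i < k.+1) 'C(k, i.+1)%:R * cos (phi + (k.+1%:R - i.+1%:R *+ 2) * th) +
    \sum_(i < k.+1) 'C(k, i)%:R * cos (phi - th + (k%:R - i%:R *+ 2) * th).
  rewrite -big_split; apply: eq_bigr => i _ /=.
  rewrite binS natrD mulrDl; congr (_ + _ * cos _).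
  by rewrite -!natr1; ring.
rewrite addrA; congr (_ + _).
rewrite big_ord_recl [X in _ = _ + X]big_ord_recr /= (bin_small (ltnSn k)) mul0r addr0.
rewrite !bin0; congr (_ * cos _ + _); first by rewrite -natr1; ring.
by apply: eq_bigr => i _; congr (_ * cos _); rewrite /bump /= -!natr1; ring.
Qed.

(** Multiplying by 2 sin (u/2), where u is the angle step, makes the sum
    telescope, and the two end terms agree by periodicity. *)
Lemma sum_cos_roots (R : realType) (K a : nat) : (0 < a < K)%N ->
  \sum_(j < K) cos (a%:R * (pi *+ 2 / K%:R) * j%:R) = 0 :> R.
Proof.
move=> /andP[a0 aK]; set u := a%:R * _.
have K0 : (0 : R) < K%:R by rewrite ltr0n (leq_ltn_trans _ aK).
have uK : u * K%:R = pi *+ 2 *+ a.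
  by rewrite /u -mulrA divfK ?gt_eqF // mulr_natl.
have su : 0 < sin (u / 2).
  apply: sin_gt0_pi; rewrite /u; apply/andP; split.
    by rewrite !mulr_gt0 ?ltr0n ?invr_gt0 // mulrn_wgt0 // pi_gt0.
  have -> : a%:R * (pi *+ 2 / K%:R) / 2 = pi * (a%:R / K%:R) :> R by field; rewrite gt_eqF.
  by rewrite gtr_pMr ?pi_gt0 // ltr_pdivrMr // mul1r ltr_nat.
apply/eqP; rewrite -(mulrI_eq0 _ (mulfI (lt0r_neq0 su))) -(mulrI_eq0 _ (mulfI (_ : 2 != 0))) //.
apply/eqP; rewrite !big_distrr /=.
pose s (j : nat) : R := sin (u * j%:R - u / 2).
have tele (j : nat) : 2 * (sin (u / 2) * cos (u * j%:R)) = s j.+1 - s j.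
  rewrite /s; have -> : u * j.+1%:R - u / 2 = u * j%:R + u / 2.
    by rewrite -natr1; field.
  by rewrite sinD sinB; ring.
under eq_bigr do rewrite tele.
rewrite -(big_mkord predT (fun j => s j.+1 - s j)) telescope_sumr // /s uK.
rewrite mulr0 sub0r -[pi *+ 2 *+ a - _]addrC (periodicn (@sinD2pi R)) subrr //.
Qed.

(** Of the frequencies 2m - 2i, all smaller than K in absolute value, only
    i = m contributes to the sum over K equally spaced angles. *)
Lemma sum_cos_power (R : realType) (K m : nat) : (m.*2 < K)%N ->
  \sum_(j < K) (2 * cos (pi *+ 2 / K%:R * j%:R)) ^+ m.*2 = K%:R * 'C(m.*2, m)%:R :> R.
Proof.
move=> mK; set u := pi *+ 2 / K%:R.
transitivity (\sum_(i < m.*2.+1) 'C(m.*2, i)%:R *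
    \sum_(j < K) cos ((m.*2%:R - i%:R *+ 2) * (u * j%:R)) : R).
  under [RHS]eq_bigr do rewrite big_distrr.
  rewrite exchange_big; apply: eq_bigr => j _ /=.
  rewrite -[LHS]mulr1 -[X in _ * X]cos0 cos_power_sum.
  by apply: eq_bigr => i _; rewrite add0r.
have mlt : (m < m.*2.+1)%N by lia.
have dbl : m.*2%:R = m%:R *+ 2 :> R by rewrite -muln2 natrM mulr_natr.
rewrite (bigD1 (Ordinal mlt)) //= dbl subrr.
under eq_bigr do rewrite mul0r cos0.
rewrite sumr_const card_ord mulrC big1 ?addr0 // => i /negP im.
have {}im : nat_of_ord i <> m by move=> e; apply: im; apply/eqP/val_inj.
have ilt := ltn_ord i.
set d := (maxn i m - minn i m)%N.*2.
rewrite [X in _ * X](_ : _ = \sum_(j < K) cos (d%:R * u * j%:R)).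
  by rewrite sum_cos_roots ?mulr0 // /d; lia.
apply: eq_bigr => j _; rewrite (_ : d%:R = (maxn i m - minn i m)%:R * 2) -?mulrA; last first.
  by rewrite /d -muln2 natrM.
have [im'|/ltnW mi] := leqP i m; rewrite natrB //; first by congr (cos _); ring.
by rewrite -[RHS]cosN; congr (cos _); ring.
Qed.

(** The Catalan numbers are the moments of the law of (2 cos th)^2 under the
    density (sin th)^2 / pi on the circle.  Replacing the integral by a Riemann
    sum with enough equally spaced angles is exact on trigonometric polynomials
    of bounded degree, which gives a finite positive measure with the first M
    moments right. *)
Lemma catalan_quadrature (R : realType) (M : nat) :
  exists (I : finType) (w x : I -> R),
    [/\ forall i, 0 <= w i, forall i, 0 <= x i <= 4 &
        forall m, (m <= M)%N -> \sum_i w i * x i ^+ m = (catalan m)%:R].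
Proof.
pose K := (M.*2.+3)%N; pose u (j : 'I_K) : R := pi *+ 2 / K%:R * j%:R.
have K0 : K%:R != 0 :> R by rewrite pnatr_eq0.
exists 'I_K, (fun j => 2 * sin (u j) ^+ 2 / K%:R), (fun j => (2 * cos (u j)) ^+ 2).
split=> [j|j|m mM].
- by rewrite divr_ge0 // pmulr_rge0 ?sqr_ge0.
- rewrite sqr_ge0 /= exprMn; have := sqr_ge0 (sin (u j)).
  rewrite sin2cos2; lra.
(* 4 sin^2 = 4 - (2 cos)^2 turns the moment into central binomials *)
transitivity ((2 * \sum_j (2 * cos (u j)) ^+ m.*2
   - 2^-1 * \sum_j (2 * cos (u j)) ^+ m.+1.*2) / K%:R).
  rewrite !big_distrr -sumrB big_distrl; apply: eq_bigr => j _ /=.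
  rewrite sin2cos2 -exprM mul2n doubleS !exprS; field.
  exact: K0.
rewrite !sum_cos_power; [|rewrite /K; lia..].
have cb : (m.+1%:R * (catalan m)%:R = 'C(m.*2, m)%:R :> R).
  by rewrite -catalan_bin natrM.
have cb' : (m.+2%:R * (catalan m.+1)%:R = 'C(m.+1.*2, m.+1)%:R :> R).
  by rewrite -catalan_bin natrM.
have cr : (m.+2%:R * (catalan m.+1)%:R = (4 * m%:R + 2) * (catalan m)%:R :> R).
  by rewrite -natrM catalan_rec natrM natrD natrM.
rewrite -cb -cb' cr -natr1; field.
exact: K0.
Qed.

(** Product of two independent copies of the previous measure. *)
Lemma catalan_sqr_quadrature (R : realType) (M : nat) :
  exists (I : finType) (w x : I -> R),
    [/\ forall i, 0 <= w i, forall i, 0 <= x i <= 16 &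
        forall m, (m <= M)%N -> \sum_i w i * x i ^+ m = (catalan m)%:R ^+ 2].
Proof.
have [I [w [x [w0 x04 wx]]]] := catalan_quadrature R M.
exists (I * I)%type, (fun p => w p.1 * w p.2), (fun p => x p.1 * x p.2).
split=> [p|p|m mM]; first exact: mulr_ge0.
- by have := x04 p.1; have := x04 p.2; move=> /andP[? ?] /andP[? ?]; apply/andP; split; nra.
rewrite expr2 -!wx // big_distrlr /= pair_bigA /=.
by apply: eq_bigr => p _; rewrite exprMn; ring.
Qed.

(** * Reduced pairs as moments of polynomials *)

(** The coefficient of u^n in (1 - u) / (1 - x u + x u^2).  Replacing each power
    x^m in it by the squared Catalan number of index m gives nreduced n. *)
Fixpoint reduced_poly {R : realType} (x : R) (n : nat) : R :=
  match n with
  | 0 => 1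
  | 1 => x - 1
  | (n'.+1 as n1).+1 => x * (reduced_poly x n1 - reduced_poly x n')
  end.

(** Both sides satisfy the recurrence of ndisjointS, since multiplying by x raises
    the number of carets by one. *)
Lemma ndisjoint_moment (R : realType) (M : nat) (I : finType) (w x : I -> R) :
  (forall m, (m <= M)%N -> \sum_i w i * x i ^+ m = (catalan m)%:R ^+ 2) ->
  forall n k, (k <= n <= M)%N ->
    (ndisjoint n k)%:R = \sum_i w i * (x i ^+ (n - k) * reduced_poly (x i) k).
Proof.
move=> wx n k; elim/ltn_ind: k n => -[|k] IHk n /andP[kn nM].
  rewrite ndisjoint0 natrX -wx //; apply: eq_bigr => i _.
  by rewrite subn0 mulr1.
case: n kn nM => [//|n] kn nM.
have -> : (ndisjoint n.+1 k.+1)%:R = (ndisjoint n.+1 k)%:R - (ndisjoint n k.-1)%:R :> R.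
  by rewrite (ndisjointS n k) // natrD addrK.
rewrite !IHk; [|lia..].
rewrite -sumrB; apply: eq_bigr => i _; rewrite -mulrBr; congr (_ * _).
case: k kn {IHk} => [|k] kn; first by rewrite !subn0 subn1 exprS /=; ring.
have -> : (n.+1 - k.+1 = (n.+1 - k.+2).+1)%N by lia.
have -> : (n - k.+1.-1 = (n.+1 - k.+2).+1)%N by rewrite /=; lia.
by rewrite exprS /=; ring.
Qed.

Lemma nreduced_moment (R : realType) (M : nat) (I : finType) (w x : I -> R) :
  (forall m, (m <= M)%N -> \sum_i w i * x i ^+ m = (catalan m)%:R ^+ 2) ->
  forall n, (1 < n <= M)%N ->
    (nreduced n)%:R = \sum_i w i * reduced_poly (x i) n.
Proof.
move=> wx n /andP[n1 nM]; rewrite nreducedE // (ndisjoint_moment _ _ _ _ _ wx) ?leqnn //.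
by apply: eq_bigr => i _; rewrite subnn mul1r.
Qed.

(** A bound c^n propagates along the recurrence as soon as x (c + 1) <= c^2;
    for x = 13 the value c = 14 works. *)
Lemma reduced_poly_small (R : realType) (x : R) n :
  0 <= x <= 13 -> `|reduced_poly x n| <= 14 ^+ n.
Proof.
move=> /andP[x0 x13].
suff: `|reduced_poly x n| <= 14 ^+ n /\ `|reduced_poly x n.+1| <= 14 ^+ n.+1 by case.
elim: n => [|n [IH0 IH1]]; first by rewrite /= normr1 expr1 ler_norml; split=> //; lra.
split=> //; rewrite [reduced_poly _ _]/= normrM (ger0_norm x0).
apply: (@le_trans _ _ (13 * (14 ^+ n.+1 + 14 ^+ n))).
  apply: ler_pM => //; apply: (le_trans (ler_normB _ _)); exact: lerD.
have : 0 <= 14 ^+ n :> R by exact: exprn_ge0.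
by rewrite !exprS; lra.
Qed.

(** The characteristic roots of the recurrence are the solutions of
    z^2 = x (z - 1).  If t is one of them, the other one is t / (t - 1). *)
Lemma reduced_poly_closed (R : realType) (t x : R) n :
  2 < t -> x = t ^+ 2 / (t - 1) ->
  reduced_poly x n =
    ((t - 1) ^+ 2 * t ^+ n - (t / (t - 1)) ^+ n) / (t * (t - 2)).
Proof.
move=> t2 ->.
have tn0 : t != 0 by lra.
have tn1 : t - 1 != 0 by lra.
have tn2 : t - 2 != 0 by lra.
elim/ltn_ind: n => -[|[|n]] IHn.
- by rewrite /= !expr0; field; rewrite tn0 tn2.
- by rewrite /= !expr1; field; rewrite tn0 tn1 tn2.
rewrite [LHS]/= -/(reduced_poly _ n.+1) !IHn // !exprS.
set T := t ^+ n; set B := (t / (t - 1)) ^+ n.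
by field; rewrite tn0 tn1 tn2.
Qed.

(** * Powers of the dominant root against powers of x *)

(** Bernoulli's inequality in logarithmic form, from the concavity of ln. *)
Lemma bernoulli_ln (R : realType) (k a : R) :
  1 <= k -> 0 <= a -> k * a < 1 -> ln (1 - k * a) <= k * ln (1 - a).
Proof.
move=> k1 a0 ka1.
have k0 : 0 < k by lra.
have ik0 : 0 <= k^-1 by rewrite invr_ge0 ltW.
have ik1 : k^-1 <= 1 by rewrite invf_le1.
have ka0 : 0 < 1 - k * a by lra.
have := concave_ln (Itv01 ik0 ik1) ka0 ltr01.
rewrite !convRE /= /unstable.onem ln1 mulr0 addr0 mulr1.
have -> : k^-1 * (1 - k * a) + (1 - k^-1) = 1 - a by field; rewrite gt_eqF.
by rewrite ler_pdivrMl.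
Qed.

Lemma ln_geB (R : realType) (z : R) : 0 < z -> 1 - z^-1 <= ln z.
Proof.
move=> z0; rewrite -[z in ln z]invrK lnV ?posrE ?invr_gt0 //.
have := @le_ln1Dx R (z^-1 - 1); rewrite addrCA subrr addr0.
have : 0 < z^-1 by rewrite invr_gt0.
by move=> iz /(_ ltac:(lra)); lra.
Qed.

(** In this section mu stands for the growth rate, i.e. for the dominant
    characteristic root at x = 16.  If the dominant root at x is t = mu (1 - a),
    then y = x / 16 equals (1 - a)^2 / (1 - kap a), and lam is the value
    of d ln t / d ln x at x = 16. *)
Section Comparison.
Variables (R : realType) (mu : R).
Hypothesis mu_itv : 14 < mu < 15.
Let kap := mu / (mu - 1).
Let lam := (mu - 1) / (mu - 2).

Lemma kap_itv : 1 <= kap <= 14 / 13.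
Proof.
case/andP: mu_itv => m1 m2.
by rewrite /kap ler_pdivlMr ?ler_pdivrMr; [lra|lra..].
Qed.

Lemma lam_itv : 1 <= lam <= 13 / 12.
Proof.
case/andP: mu_itv => m1 m2.
by rewrite /lam ler_pdivlMr ?ler_pdivrMr; [lra|lra..].
Qed.

Lemma lam_kap : lam * (2 - kap) = 1.
Proof.
by case/andP: mu_itv => m1 m2; rewrite /lam /kap; field; apply/andP; split; lra.
Qed.

(** Since lam (2 - kap) = 1, the quantity equals
    lam (kap ln (1 - a) - ln (1 - kap a)): its first order terms in a cancel,
    and it is nonnegative by Bernoulli. *)
Lemma log_defect a : 0 <= a <= 4 / 15 ->
  0 <= lam * ln ((1 - a) ^+ 2 / (1 - kap * a)) - ln (1 - a) <= 2 * a ^+ 2.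
Proof.
move=> /andP[a0 a1]; have /andP[k1 k2] := kap_itv; have /andP[l1 l2] := lam_itv.
have ka : kap * a <= 3 / 10 by nra.
have ka0 : 0 <= kap * a by nra.
rewrite ln_div ?posrE ?exprn_gt0; [|lra..].
rewrite lnXn; last lra.
rewrite (_ : _ - _ = lam * (kap * ln (1 - a) - ln (1 - kap * a))); last first.
  rewrite [LHS](_ : _ = lam * (kap * ln (1 - a) - ln (1 - kap * a))
    + (lam * (2 - kap) - 1) * ln (1 - a)); last by ring.
  by rewrite lam_kap subrr mul0r addr0.
have low : ln (1 - kap * a) <= kap * ln (1 - a) by apply: bernoulli_ln => //; lra.
have up1 : ln (1 - a) <= - a by apply: le_ln1Dx; lra.
have up2 : 1 - (1 - kap * a)^-1 <= ln (1 - kap * a) by apply: ln_geB; lra.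
have up3 : (1 - kap * a)^-1 - 1 <= kap * a + 10 / 7 * (kap * a) ^+ 2.
  rewrite lerBlDr invf_ple ?posrE; [|nra|nra].
  rewrite -[leLHS]mul1r ler_pdivrMr; nra.
apply/andP; split; first by apply: mulr_ge0; lra.
have e : kap * ln (1 - a) - ln (1 - kap * a) <= 10 / 7 * (kap * a) ^+ 2 by nra.
have kk : kap ^+ 2 <= 14 / 13 * (14 / 13) by nra.
have : lam * (10 / 7 * (kap * a) ^+ 2) <= 2 * a ^+ 2.
  rewrite exprMn mulrA mulrA; apply: ler_wpM2r; first exact: sqr_ge0.
  nra.
apply: le_trans; apply: ler_wpM2l => //; lra.
Qed.

(** As t / mu = y^lam up to the defect just bounded, (t / mu)^n is compared with
    a power of y whose integer exponent m is the integer part of lam n. *)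
Lemma power_sandwich a (n m : nat) : 0 <= a <= 4 / 15 ->
  m%:R <= lam * n%:R <= m%:R + 1 ->
  let y := (1 - a) ^+ 2 / (1 - kap * a) in
  y <= 1 ->
  y ^+ m.+1 * (1 - 2 * n%:R * a ^+ 2) <= (1 - a) ^+ n <= y ^+ m.
Proof.
move=> a_itv /andP[mn nm] y y1; have /andP[D0 D2] := log_defect a a_itv.
have /andP[a0 a1] := a_itv; have /andP[k1 k2] := kap_itv.
rewrite -/y in D0 D2; set D := lam * ln y - _ in D0 D2.
have y0 : 0 < y by rewrite /y divr_gt0 ?exprn_gt0 //; nra.
have ly : ln y <= 0 by exact: ln_le0.
have powE z k : 0 < z -> z ^+ k = expR (k%:R * ln z) by move=> z0; rewrite expRM_natl lnK.
have n0 : 0 <= n%:R :> R by [].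
have lnE : n%:R * ln (1 - a) = lam * n%:R * ln y - n%:R * D by rewrite /D; ring.
rewrite [(1 - a) ^+ n]powE ?[y ^+ m]powE ?[y ^+ m.+1]powE //; last lra.
rewrite lnE ler_expR; apply/andP; split; last by nra.
rewrite expRD; apply: (@le_trans _ _ (expR (m.+1%:R * ln y) * expR (- (n%:R * D)))).
  apply: ler_wpM2l; first exact: expR_ge0.
  apply: le_trans (expR_ge1Dx _); nra.
apply: ler_wpM2r; first exact: expR_ge0.
by rewrite ler_expR -natr1; nra.
Qed.
End Comparison.

(** * Approximation of the polynomials by a single power *)

(** The larger root of t^2 = x (t - 1); it increases with x and equals mu at
    x = 16. *)
Lemma dominant_root_exists (R : realType) (mu x : R) :
  14 < mu -> mu ^+ 2 = 16 * (mu - 1) -> 13 <= x <= 16 ->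
  exists t : R, 11 <= t <= mu /\ x = t ^+ 2 / (t - 1).
Proof.
move=> mu14 mu_eq /andP[x13 x16].
pose d := Num.sqrt (x ^+ 2 - 4 * x); pose t := (x + d) / 2.
have d2 : d ^+ 2 = x ^+ 2 - 4 * x by rewrite sqr_sqrtr; nra.
have d0 : 0 <= d by exact: sqrtr_ge0.
have d9 : 9 <= d by nra.
have t11 : 11 <= t by rewrite /t; lra.
have t2 : t ^+ 2 = x * (t - 1).
  by rewrite /t expr_div_n sqrrD d2; field.
exists t; split; last by rewrite t2 mulfK //; lra.
rewrite t11 /= leNgt; apply/negP => mut.
(* t^2 (mu - 1) <= mu^2 (t - 1), from x <= 16, factors through mu - t *)
have : 16 * (mu - t) * (mu * t - mu - t) = (mu - 1) * (t - 1) * 16 * (16 - x).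
  rewrite mulrBr -[in RHS]mulrA.
  have -> : (mu - 1) * (t - 1) * (16 * (16 - x)) =
    16 * (16 * (mu - 1) * (t - 1) - (mu - 1) * (x * (t - 1))) by ring.
  by rewrite -mu_eq -t2; ring.
have : 0 < mu * t - mu - t by nra.
have : 0 <= (mu - 1) * (t - 1) * 16 * (16 - x) by rewrite !mulr_ge0; lra.
nra.
Qed.

Section Approximation.
Variables (R : realType) (mu : R).
Hypotheses (mu_itv : 14 < mu < 15) (mu_eq : mu ^+ 2 = 16 * (mu - 1)).

Lemma amplitude_defect (t : R) : 11 <= t <= mu ->
  0 <= (t * (t - 2))^-1 - (mu * (mu - 2))^-1 <= 1 - t / mu.
Proof.
move: mu_itv => /andP[mu14 mu15] /andP[t11 tmu].
have -> : (t * (t - 2))^-1 - (mu * (mu - 2))^-1 =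
    (1 - t / mu) * ((mu + t - 2) / (t * (t - 2) * (mu - 2))).
  by field; do ![apply/andP; split]; lra.
have tt : 90 <= t * (t - 2) by nra.
have q : mu + t - 2 <= t * (t - 2) * (mu - 2) by nra.
have a0 : 0 <= 1 - t / mu by rewrite subr_ge0 ler_pdivrMr; lra.
have q0 : 0 < t * (t - 2) * (mu - 2) by nra.
rewrite mulr_ge0 ?divr_ge0 ?(ltW q0) //=; last lra.
by rewrite -[leRHS]mulr1 ler_wpM2l // ler_pdivrMr // mul1r.
Qed.

(** The distance of t to mu, relative to mu, is controlled by the distance of x
    to 16, because x is a smooth function of t with nonzero derivative at mu. *)
Lemma dominant_root_gap (t : R) : 11 <= t <= mu ->
  [/\ 0 <= 1 - t / mu <= 4 / 15,
      (1 - (1 - t / mu)) ^+ 2 / (1 - mu / (mu - 1) * (1 - t / mu)) =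
        t ^+ 2 / (t - 1) / 16 &
      1 - t / mu <= 2 * (1 - t ^+ 2 / (t - 1) / 16)].
Proof.
move: mu_itv => /andP[mu14 mu15] /andP[t11 tmu].
have ya : (1 - (1 - t / mu)) ^+ 2 / (1 - mu / (mu - 1) * (1 - t / mu)) =
    t ^+ 2 / (t - 1) / 16.
  have -> : 16 = mu ^+ 2 / (mu - 1) by rewrite mu_eq mulfK //; lra.
  by field; do ![apply/andP; split]; lra.
have amu : (1 - t / mu) * mu = mu - t by field; lra.
move: (1 - t / mu) ya amu => a ya amu.
have a0 : 0 <= a by nra.
have a1 : a <= 4 / 15 by nra.
split=> //; first by rewrite a0.
have : a * (mu / (mu - 1)) <= a * (14 / 13).
  by apply: ler_wpM2l => //; rewrite ler_pdivrMr; lra.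
rewrite -ya [_ * a]mulrC; move: (a * (mu / (mu - 1))) => k k2.
have sq : (1 - a) ^+ 2 <= (1 - a / 2) * (1 - k) by nra.
have : (1 - a) ^+ 2 / (1 - k) <= 1 - a / 2 by rewrite ler_pdivrMr //; lra.
lra.
Qed.

(** The second root t / (t - 1) contributes a negative term, negligible because
    this root is close to 1. *)
Lemma reduced_poly_dominant (t : R) n : 11 <= t <= mu ->
  let p := reduced_poly (t ^+ 2 / (t - 1)) n / mu ^+ n in
  let q := (1 + (t * (t - 2))^-1) * (t / mu) ^+ n in
  q - (14 / mu) ^+ n <= p <= q.
Proof.
move: mu_itv => /andP[mu14 mu15] /andP[t11 tmu].
have mun0 : 0 < mu ^+ n by rewrite exprn_gt0 //; lra.
have tt1 : 1 <= t * (t - 2) by nra.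
have b0 : 0 <= t / (t - 1) by rewrite divr_ge0; lra.
have b14 : t / (t - 1) <= 14 by rewrite ler_pdivrMr; lra.
have bn0 : 0 <= (t / (t - 1)) ^+ n by exact: exprn_ge0.
have bn : (t / (t - 1)) ^+ n <= 14 ^+ n by apply: lerXn2r; rewrite ?nnegrE.
rewrite (reduced_poly_closed _ t) /=; [|lra|by []].
rewrite [(t / mu) ^+ n]expr_div_n [(14 / mu) ^+ n]expr_div_n.
move: ((t / (t - 1)) ^+ n) bn0 bn => B bn0 bn.
move: (t ^+ n) (mu ^+ n) (14 ^+ n) mun0 bn => T W E W0 bn.
have -> : ((t - 1) ^+ 2 * T - B) / (t * (t - 2)) / W =
    (1 + (t * (t - 2))^-1) * (T / W) - B / (t * (t - 2)) / W.
  by field; do ![apply/andP; split]; lra.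
have tt0 : 0 < t * (t - 2) by lra.
have e0 : 0 <= B / (t * (t - 2)) / W by rewrite !divr_ge0 // ltW.
have e1 : B / (t * (t - 2)) / W <= E / W.
  rewrite ler_pM2r ?invr_gt0 // ler_pdivrMr //; nra.
by move: e0 e1; move: (B / _ / _) (E / W) (_ * (T / W)) => *; apply/andP; split; lra.
Qed.

End Approximation.

(** Here Y is y^m, P is (t / mu)^n, h and H are the amplitudes minus 1 of the
    dominant term at x = 16 and at x, and E bounds the neglected terms. *)
Lemma approx_combine (R : realFieldType) (n y Y a P p h H E : R) :
  0 <= n -> 0 <= y <= 1 -> 0 <= Y -> 0 <= P ->
  0 <= a <= 2 * (1 - y) -> 0 <= h <= 1 -> 0 <= H - h <= a ->
  y * Y * (1 - 2 * n * a ^+ 2) <= P <= Y -> (1 + H) * P - E <= p <= (1 + H) * P ->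
  `|p - (1 + h) * Y| <= 16 * ((1 - y) + n * (1 - y) ^+ 2) * Y + E.
Proof.
move=> n0 /andP[y0 y1] Y0 P0 /andP[a0 a1] /andP[h0 h1] /andP[d0 d1].
move=> /andP[lo up] /andP[p1 p2].
have dP : Y - P <= ((1 - y) + 8 * (n * (1 - y) ^+ 2)) * Y.
  have a2 : a ^+ 2 <= 4 * (1 - y) ^+ 2 by nra.
  have na2 : n * a ^+ 2 <= n * (4 * (1 - y) ^+ 2) by exact: ler_wpM2l.
  have na0 : 0 <= n * a ^+ 2 by rewrite mulr_ge0 ?sqr_ge0.
  move: lo na2 na0; rewrite -mulrA -[2 * n * _]mulrA.
  rewrite (_ : n * (4 * (1 - y) ^+ 2) = 4 * (n * (1 - y) ^+ 2)); last by ring.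
  move: (n * a ^+ 2) (n * (1 - y) ^+ 2) => u v lo uv u0.
  have yu : y * u <= 4 * v by nra.
  have : Y * (y * u) <= Y * (4 * v) by exact: ler_wpM2l.
  lra.
have h2 : (H - h) * P <= 2 * (1 - y) * Y by apply: ler_pM => //; lra.
have h3 : 0 <= (H - h) * P by rewrite mulr_ge0.
have h4 : (1 + h) * (Y - P) <= 2 * (Y - P) by rewrite ler_wpM2r ?subr_ge0 //; lra.
have h5 : 0 <= (1 + h) * (Y - P) by rewrite mulr_ge0 ?subr_ge0 //; lra.
have h6 : 0 <= n * (1 - y) ^+ 2 * Y by rewrite mulr_ge0 // mulr_ge0 // sqr_ge0.
have h7 : 0 <= (1 - y) * Y by rewrite mulr_ge0 ?subr_ge0.
rewrite ler_norml; apply/andP; split; lra.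
Qed.

(** The error bound is again a polynomial in x / 16, so that its mean against
    the quadrature is computed exactly by the moments; its main term vanishes
    at x = 16, where (x / 16)^m concentrates.  For x <= 13 both terms on the left
    are at most a constant times (14 / mu)^n, and power_sandwich is used beyond
    that point. *)
Lemma reduced_poly_approx (R : realType) (mu x : R) (n m : nat) :
  14 < mu < 15 -> mu ^+ 2 = 16 * (mu - 1) -> 0 <= x <= 16 -> (n <= m)%N ->
  m%:R <= (mu - 1) / (mu - 2) * n%:R <= m%:R + 1 ->
  `|reduced_poly x n / mu ^+ n - (1 + (mu * (mu - 2))^-1) * (x / 16) ^+ m| <=
    16 * ((1 - x / 16) + n%:R * (1 - x / 16) ^+ 2) * (x / 16) ^+ m
    + 3 * (14 / mu) ^+ n.
Proof.
move=> mu_itv mu_eq /andP[x0 x16] nm mn_itv; have /andP[mu14 mu15] := mu_itv.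
have mun0 : 0 < mu ^+ n by rewrite exprn_gt0 //; lra.
have y0 : 0 <= x / 16 by lra.
have y1 : x / 16 <= 1 by lra.
have ym0 : 0 <= (x / 16) ^+ m by exact: exprn_ge0.
have n0 : 0 <= n%:R :> R by [].
have E0 : 0 <= (14 / mu) ^+ n by rewrite exprn_ge0 // divr_ge0; lra.
have h_itv : 0 <= (mu * (mu - 2))^-1 <= 1.
  have mm : 1 <= mu * (mu - 2) by nra.
  by rewrite invr_ge0 invf_le1 //; lra.
have [x13|/ltW x13] := leP x 13.
  have main : 0 <= 16 * ((1 - x / 16) + n%:R * (1 - x / 16) ^+ 2) * (x / 16) ^+ m.
    rewrite mulr_ge0 // mulr_ge0 // addr_ge0 ?subr_ge0 // mulr_ge0 // sqr_ge0 //.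
  have small : `|reduced_poly x n / mu ^+ n| <= (14 / mu) ^+ n.
    rewrite normrM normfV (ger0_norm (ltW mun0)) expr_div_n ler_pM2r ?invr_gt0 //.
    by apply: reduced_poly_small; rewrite x0.
  (* 13 / 16 <= 14 / 15 < 14 / mu *)
  have ymE : (x / 16) ^+ m <= (14 / mu) ^+ n.
    apply: (@le_trans _ _ ((x / 16) ^+ n)); first exact: ler_wiXn2l.
    apply: lerXn2r; rewrite ?nnegrE ?divr_ge0 //; [lra|].
    by rewrite ler_pdivlMr; nra.
  apply: le_trans (ler_normB _ _) _.
  have : `|(1 + (mu * (mu - 2))^-1) * (x / 16) ^+ m| <= 2 * (x / 16) ^+ m.
    by rewrite normrM (ger0_norm ym0) ger0_norm ?ler_wpM2r //; lra.
  lra.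
have x_itv : 13 <= x <= 16 by rewrite x13.
have [t [t_itv xt]] := dominant_root_exists _ _ _ mu14 mu_eq x_itv.
have G_itv := amplitude_defect _ _ mu_itv t t_itv.
have [a_itv ya ay] := dominant_root_gap _ _ mu_itv mu_eq t t_itv.
have p_itv := reduced_poly_dominant _ _ mu_itv t n t_itv.
have /= := power_sandwich R mu mu_itv _ n m a_itv mn_itv.
rewrite ya [_ ^+ m.+1]exprS => sand.
rewrite -[t / mu](subKr 1) -xt in p_itv.
rewrite -xt in ay sand.
have /andP[a0 a4] := a_itv.
have approx := approx_combine R n%:R (x / 16) ((x / 16) ^+ m) (1 - t / mu)
  ((1 - (1 - t / mu)) ^+ n) _ _ _ _ n0 _ ym0 _ _ h_itv G_itv (sand y1) p_itv.
apply: le_trans (approx _ _ _) _; [by rewrite y0|by rewrite exprn_ge0 //; lra|by rewrite a0|lra].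
Qed.

(** * Squared Catalan numbers and their differences *)

Definition catalan_moment (R : realType) (m : nat) : R :=
  (catalan m)%:R ^+ 2 / 16 ^+ m.

Lemma catalan_momentS (R : realType) m :
  catalan_moment R m.+1 = catalan_moment R m * ((2 * m%:R + 1) / (2 * m%:R + 4)) ^+ 2.
Proof.
rewrite /catalan_moment [16 ^+ _]exprS.
have m0 : 0 <= m%:R :> R by [].
have E0 : 16 ^+ m != 0 :> R by rewrite expf_neq0.
have cr : (m%:R + 2) * (catalan m.+1)%:R = (4 * m%:R + 2) * (catalan m)%:R :> R.
  have := catalan_rec m => /(congr1 (fun k => k%:R : R)).
  by rewrite !natrM natrD natrM -addn2 natrD.
have -> : (catalan m.+1)%:R = (4 * m%:R + 2) / (m%:R + 2) * (catalan m)%:R :> R.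
  by rewrite mulrAC -cr mulrAC mulfV ?mul1r //; lra.
by field; rewrite E0 /=; lra.
Qed.

Lemma catalan_moment_ge0 (R : realType) m : 0 <= catalan_moment R m.
Proof. by rewrite divr_ge0 // exprn_ge0. Qed.

Lemma catalan_moment_diff (R : realType) m :
  catalan_moment R m - catalan_moment R m.+1 <= 3 * (catalan_moment R m / m.+1%:R).
Proof.
have m0 : 0 <= m%:R :> R by [].
rewrite catalan_momentS -[m.+1%:R]natr1.
move: (catalan_moment R m) (catalan_moment_ge0 R m) => v v0.
move: (m%:R : R) m0 => s s0.
rewrite -subr_ge0 [leRHS](_ : _ = v * ((21 * s + 33) / ((s + 1) * (2 * s + 4) ^+ 2))).
  rewrite mulr_ge0 // divr_ge0 //; first lra.
  by rewrite mulr_ge0 ?sqr_ge0 //; lra.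
by field; apply/andP; split; lra.
Qed.

Lemma catalan_moment_diff2 (R : realType) m :
  catalan_moment R m - 2 * catalan_moment R m.+1 + catalan_moment R m.+2 <=
    20 * (catalan_moment R m / m.+1%:R ^+ 2).
Proof.
have m0 : 0 <= m%:R :> R by [].
rewrite !catalan_momentS -[m.+1%:R]natr1.
move: (catalan_moment R m) (catalan_moment_ge0 R m) => v v0.
move: (m%:R : R) m0 => s s0.
rewrite [leLHS](_ : _ = v * ((12 * s ^+ 2 + 42 * s + 32 + 16^-1) / ((s + 2) * (s + 3)) ^+ 2)).
  rewrite (mulrCA 20); apply: ler_wpM2l => //.
  rewrite ler_pdivrMr; last by rewrite exprn_gt0 // mulr_gt0; lra.
  rewrite mulrAC ler_pdivlMr; last by rewrite exprn_gt0; lra.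
  have s2 : 0 <= s ^+ 2 by exact: sqr_ge0.
  have num : 12 * s ^+ 2 + 42 * s + 32 + 16^-1 <= 20 * ((s + 2) * (s + 3)) by lra.
  have den : (s + 1) ^+ 2 <= (s + 2) * (s + 3) by lra.
  rewrite [X in 20 * X]expr2 [leRHS]mulrA.
  apply: ler_pM; [lra|exact: sqr_ge0|exact: num|exact: den].
by field; do ![apply/andP; split]; lra.
Qed.

(** This is m times the square of 'C(2m, m) / 4^m: a normalisation that makes
    the sequence monotone. *)
Definition scaled_moment (R : realType) (m : nat) : R :=
  m%:R * m.+1%:R ^+ 2 * catalan_moment R m.

(** With the factor m + 1/2 in place of m the sequence is nonincreasing. *)
Lemma scaled_moment_bound (R : realType) m : scaled_moment R m <= 1.
Proof.
suff : (m%:R + 2^-1) * m.+1%:R ^+ 2 * catalan_moment R m <= 1.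
  apply: le_trans; apply: ler_wpM2r; first exact: catalan_moment_ge0.
  by apply: ler_wpM2r; [exact: sqr_ge0|lra].
elim: m => [|m IHm].
  by rewrite /catalan_moment catalan0 expr1n expr0 !mulr1; lra.
apply: le_trans IHm; rewrite catalan_momentS -[m.+2%:R]natr1 -[m.+1%:R]natr1.
have m0 : 0 <= m%:R :> R by [].
move: (catalan_moment R m) (catalan_moment_ge0 R m) => v v0.
move: (m%:R : R) m0 => s s0.
rewrite mulrCA [leRHS]mulrC; apply: ler_wpM2l => //.
rewrite [leLHS](_ : _ = (s + 1 + 2^-1) * (s + 2^-1) ^+ 2); last by field; lra.
nra.
Qed.

Lemma scaled_moment_nondecreasing (R : realType) m :
  scaled_moment R m <= scaled_moment R m.+1.
Proof.
rewrite /scaled_moment catalan_momentS -[m.+2%:R]natr1 -[m.+1%:R]natr1.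
have m0 : 0 <= m%:R :> R by [].
move: (catalan_moment R m) (catalan_moment_ge0 R m) => v v0.
move: (m%:R : R) m0 => s s0.
rewrite [leRHS]mulrCA [leLHS]mulrC; apply: ler_wpM2l => //.
rewrite [leRHS](_ : _ = (s + 1) * (s + 2^-1) ^+ 2); last by field; lra.
nra.
Qed.

(** The mean of reduced_poly_approx against the quadrature of degree m + 2: the
    factors 1 - y and (1 - y)^2 become first and second differences of the
    moments. *)
Lemma nreduced_approx (R : realType) (mu : R) (n m : nat) :
  14 < mu < 15 -> mu ^+ 2 = 16 * (mu - 1) -> (1 < n <= m)%N ->
  m%:R <= (mu - 1) / (mu - 2) * n%:R <= m%:R + 1 ->
  `|(nreduced n)%:R / mu ^+ n - (1 + (mu * (mu - 2))^-1) * catalan_moment R m| <=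
    16 * ((catalan_moment R m - catalan_moment R m.+1) + n%:R *
      (catalan_moment R m - 2 * catalan_moment R m.+1 + catalan_moment R m.+2))
    + 3 * (14 / mu) ^+ n.
Proof.
move=> mu_itv mu_eq /andP[n1 nm] mn_itv.
have [I [w [x [w0 x16 wx]]]] := catalan_sqr_quadrature R m.+2.
have wy k : (k <= m.+2)%N -> \sum_i w i * (x i / 16) ^+ k = catalan_moment R k.
  move=> km; rewrite /catalan_moment -wx // big_distrl.
  by apply: eq_bigr => i _; rewrite expr_div_n mulrA.
have w1 : \sum_i w i = 1.
  have := wy 0 isT; rewrite /catalan_moment catalan0 expr1n expr0 divr1 => <-.
  by apply: eq_bigr => i _; rewrite expr0 mulr1.
rewrite (nreduced_moment R m.+2 I w x wx) ?n1 ?(leq_trans nm) //; last lia.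
set h := 1 + _; set E := 3 * _.
have -> : (\sum_i w i * reduced_poly (x i) n) / mu ^+ n - h * catalan_moment R m =
    \sum_i w i * (reduced_poly (x i) n / mu ^+ n - h * (x i / 16) ^+ m).
  rewrite -wy; last lia.
  by rewrite big_distrl big_distrr -sumrB; apply: eq_bigr => i _ /=; ring.
apply: (@le_trans _ _ (\sum_i w i *
    (16 * ((1 - x i / 16) + n%:R * (1 - x i / 16) ^+ 2) * (x i / 16) ^+ m + E))).
  apply: le_trans (ler_norm_sum _ _ _) _; apply: ler_sum => i _.
  rewrite normrM (ger0_norm (w0 i)); apply: ler_wpM2l => //.
  exact: reduced_poly_approx.
rewrite le_eqVlt; apply/orP; left; apply/eqP.
rewrite -[E in RHS]mulr1 -[X in E * X]w1 -!wy; [|lia..].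
transitivity ((16 + 16 * n%:R) * (\sum_i w i * (x i / 16) ^+ m)
  - (16 + 32 * n%:R) * (\sum_i w i * (x i / 16) ^+ m.+1)
  + 16 * n%:R * (\sum_i w i * (x i / 16) ^+ m.+2) + E * \sum_i w i); last by ring.
rewrite !big_distrr /= -sumrB -!big_split; apply: eq_bigr => i _ /=.
by rewrite ![(x i / 16) ^+ _.+1]exprS; ring.
Qed.

(** * Limits *)

Local Open Scope classical_set_scope.
Local Open Scope ring_scope.

Lemma scaled_moment_cvg (R : realType) :
  exists c : R, 0 < c /\ scaled_moment R @ \oo --> c.
Proof.
have nd : nondecreasing_seq (scaled_moment R).
  by apply/nondecreasing_seqP => m; exact: scaled_moment_nondecreasing.
have ub : has_ubound (range (scaled_moment R)).
  by exists 1 => _ [m _ <-]; exact: scaled_moment_bound.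
have cv := nondecreasing_is_cvgn nd ub.
exists (limn (scaled_moment R)); split; last exact: cv.
apply: (@lt_le_trans _ _ (scaled_moment R 1)).
  rewrite /scaled_moment /catalan_moment; have := catalan_bin 1.
  by rewrite mul2n; case: (catalan 1) => //= k _; rewrite !mulr_gt0 ?exprn_gt0 ?invr_gt0 ?ltr0n.
exact: nondecreasing_cvgn_le.
Qed.

(** The inverse of q^n is at least the quartic term of its exponential series,
    so that n^4 q^n is bounded. *)
Lemma cube_geometric_bound (R : realType) (q : R) : 0 < q < 1 ->
  exists K : R, forall n, n.+1%:R * (n%:R ^+ 3 * q ^+ n) <= K.
Proof.
move=> /andP[q0 q1]; pose L := - ln q.
have L0 : 0 < L by rewrite oppr_gt0 ln_lt0 // q0.
exists (2 * (4`!%:R / L ^+ 4)) => n.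
have n0 : 0 <= n%:R :> R by [].
have qn0 : 0 < q ^+ n by exact: exprn_gt0.
have L4 : 0 < L ^+ 4 by exact: exprn_gt0.
have qE : q ^+ n = (expR (n%:R * L))^-1 by rewrite -expRN -mulrN opprK expRM_natl lnK.
have quartic : n%:R ^+ 4 * q ^+ n <= 4`!%:R / L ^+ 4.
  rewrite ler_pdivlMr // mulrAC -exprMn qE ler_pdivrMr ?expR_gt0 //.
  have f0 : 0 < 4`!%:R :> R by rewrite ltr0n.
  rewrite -ler_pdivrMl // mulrC.
  have nL : 0 <= n%:R * L by rewrite mulr_ge0 // ltW.
  by apply: le_trans (expR_ge1Dxn 3 nL); rewrite lerDr.
apply: (@le_trans _ _ (2 * (n%:R ^+ 4 * q ^+ n))); last by rewrite ler_wpM2l.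
rewrite [leLHS]mulrA [leRHS]mulrA; apply: ler_wpM2r; first exact: ltW.
case: n {qn0 qE quartic} n0 => [|n] n0; first by rewrite mulr0n !expr0n !mulr0.
rewrite (exprS _ 3) [leRHS]mulrA; apply: ler_wpM2r; first exact: exprn_ge0.
by rewrite -natrM ler_nat; lia.
Qed.

Lemma truncn_ratio_cvg (R : realType) (lam : R) : 0 <= lam ->
  (Num.truncn (lam * n%:R))%:R / n%:R @[n --> \oo] --> lam.
Proof.
move=> l0; apply: (@squeeze_cvgr _ _ _ _ (fun n => lam - n%:R^-1) (fun=> lam)).
- near=> n; have n0 : 0 < n%:R :> R by rewrite ltr0n; near: n; exact: nbhs_infty_gt.
  have /andP[lo up] := Num.Theory.truncn_itv (mulr_ge0 l0 (ltW n0)).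
  rewrite ler_pdivrMr // lo andbT ler_pdivlMr // mulrBl mulVf ?gt_eqF //.
  by rewrite lerBlDr natr1 ltW.
- rewrite -[X in _ --> X]subr0; apply: cvgB; first exact: cvg_cst.
  by rewrite -(cvg_shiftS (fun n => n%:R^-1 : R)); exact: cvg_harmonic.
- exact: cvg_cst.
Unshelve. all: by end_near. Qed.

(** If m is the integer part of lam n then n^3 times the moment of order m is
    scaled_moment m divided by (m / n) ((m + 1) / n)^2, whose limit is lam^3. *)
Lemma cubed_moment_cvg (R : realType) (lam c : R) : 1 <= lam ->
  scaled_moment R @ \oo --> c ->
  n%:R ^+ 3 * catalan_moment R (Num.truncn (lam * n%:R)) @[n --> \oo] --> c / lam ^+ 3.
Proof.
move=> lam1 cvc; pose m n := Num.truncn (lam * n%:R).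
have lam0 : 0 <= lam by lra.
have nm n : (n <= m n)%N.
  by rewrite /m truncn_ge_nat ?mulr_ge0 // ler_peMl.
have m_infty : m @ \oo --> \oo.
  by apply/cvgnyPge => A; near=> n; apply: leq_trans (nm n); near: n; exact: nbhs_infty_ge.
have cvz : scaled_moment R (m n) @[n --> \oo] --> c by exact: cvg_comp m_infty cvc.
have ratio := truncn_ratio_cvg R lam lam0.
have inv0 : n%:R^-1 @[n --> \oo] --> (0 : R).
  by rewrite -(cvg_shiftS (fun n => n%:R^-1 : R)); exact: cvg_harmonic.
have ratio1 : (m n)%:R / n%:R + n%:R^-1 @[n --> \oo] --> lam.
  by rewrite -[lam]addr0; exact: cvgD.
have den : (m n)%:R / n%:R * (((m n)%:R / n%:R + n%:R^-1) * ((m n)%:R / n%:R + n%:R^-1))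
    @[n --> \oo] --> lam * (lam * lam).
  by apply: cvgM => //; exact: cvgM.
have lam3 : lam * (lam * lam) != 0 by rewrite !mulf_neq0 //; lra.
have -> : c / lam ^+ 3 = c * (lam * (lam * lam))^-1 by rewrite !exprS expr0 mulr1.
apply: (cvg_trans _ (cvgM cvz (cvgV lam3 den))); apply: near_eq_cvg; near=> n.
have n0 : 0 < n%:R :> R by rewrite ltr0n; near: n; exact: nbhs_infty_gt.
have mn0 : 0 < (m n)%:R :> R by rewrite (lt_le_trans n0) // ler_nat.
rewrite /= /scaled_moment -[(m n).+1%:R]natr1 -/(m n).
by field; do ![apply/andP; split]; lra.
Unshelve. all: by end_near. Qed.

(** The moments decay like m^(-3), their first and second differences are
    smaller by factors 1 / m and 1 / m^2, and n <= m: hence n^3 times the error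
    of nreduced_approx is O(1 / n). *)
Lemma nreduced_cubed_error (R : realType) (mu : R) :
  14 < mu < 15 -> mu ^+ 2 = 16 * (mu - 1) ->
  exists K : R, forall n, (1 < n)%N ->
    n%:R ^+ 3 * `|(nreduced n)%:R / mu ^+ n - (1 + (mu * (mu - 2))^-1) *
      catalan_moment R (Num.truncn ((mu - 1) / (mu - 2) * n%:R))| <= K * n.+1%:R^-1.
Proof.
move=> mu_itv mu_eq; have /andP[mu14 mu15] := mu_itv.
have /andP[lam1 _] := lam_itv _ _ mu_itv.
have [K qK] : exists K : R, forall n, n.+1%:R * (n%:R ^+ 3 * (14 / mu) ^+ n) <= K.
  apply: cube_geometric_bound; rewrite divr_gt0 ?ltr_pdivrMr ?mul1r //; lra.
(* 368 = 16 * (3 + 20), from the bounds on first and second differences *)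
exists (368 + 3 * K) => n n1.
have n0 : 0 <= n%:R :> R by [].
have ln0 : 0 <= (mu - 1) / (mu - 2) * n%:R by apply: mulr_ge0 => //; lra.
have /andP[lo up] := truncn_itv ln0.
have nm : (n <= Num.truncn ((mu - 1) / (mu - 2) * n%:R))%N.
  by rewrite truncn_ge_nat // ler_peMl.
move: (Num.truncn _) nm lo up => m nm lo up.
have n3 : 0 <= n%:R ^+ 3 :> R by exact: exprn_ge0.
have S0 : 0 < n.+1%:R :> R by rewrite ltr0n.
rewrite ler_pdivlMr // mulrC.
have /(ler_wpM2l n3)/(ler_wpM2l (ltW S0)) := nreduced_approx R mu n m mu_itv mu_eq
  ltac:(by rewrite n1) ltac:(by rewrite lo natr1 ltW).
move/le_trans; apply.
set v := catalan_moment R m.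
have v0 : 0 <= v by exact: catalan_moment_ge0.
have nmR : n%:R <= m%:R :> R by rewrite ler_nat.
have n3v : n%:R ^+ 3 * v <= 1.
  apply: le_trans (scaled_moment_bound R m); rewrite /scaled_moment -/v.
  apply: ler_wpM2r => //; rewrite exprS; apply: ler_pM; [by []|exact: exprn_ge0|exact: nmR|].
  by apply: lerXn2r; rewrite ?nnegrE // -natr1; lra.
have M0 : 0 < m.+1%:R :> R by rewrite ltr0n.
have d1 := catalan_moment_diff R m.
have d2 : n%:R * (v - 2 * catalan_moment R m.+1 + catalan_moment R m.+2) <= 20 * (v / m.+1%:R).
  apply: le_trans (ler_wpM2l n0 (catalan_moment_diff2 R m)) _; rewrite -/v.
  rewrite mulrCA; apply: ler_wpM2l => //.
  rewrite mulrCA; apply: ler_wpM2l => //.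
  rewrite ler_pdivrMr ?exprn_gt0 // expr2 mulKf ?gt_eqF // -natr1; lra.
have vm : n.+1%:R * (n%:R ^+ 3 * (v / m.+1%:R)) <= 1.
  rewrite (_ : _ * _ = (n%:R ^+ 3 * v) * (n.+1%:R / m.+1%:R)); last by ring.
  rewrite -[leRHS]mulr1; apply: ler_pM; [exact: mulr_ge0|by rewrite divr_ge0|exact: n3v|].
  by rewrite ler_pdivrMr // mul1r ler_nat ltnS.
rewrite -/v in d1; have := qK n.
set q := (14 / mu) ^+ n => qn.
have : n.+1%:R * (n%:R ^+ 3 * (16 * (v - catalan_moment R m.+1 +
    n%:R * (v - 2 * catalan_moment R m.+1 + catalan_moment R m.+2)) + 3 * q)) <=
  n.+1%:R * (n%:R ^+ 3 * (368 * (v / m.+1%:R) + 3 * q)).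
  apply: ler_wpM2l; first exact: ltW.
  apply: ler_wpM2l => //; rewrite lerD2r.
  move: (v / _) (v - catalan_moment R m.+1) (n%:R * (v - _ + _)) d1 d2 => u d e d1 d2.
  lra.
move/le_trans; apply.
rewrite (_ : _ * _ = 368 * (n.+1%:R * (n%:R ^+ 3 * (v / m.+1%:R)))
  + 3 * (n.+1%:R * (n%:R ^+ 3 * q))); last by ring.
by rewrite -[X in _ <= X + _]mulr1; apply: lerD; exact: ler_wpM2l.
Qed.

Theorem proposition4 (R : realType) :
  exists A : R, 0 < A /\
    asymp_equiv (fun n : nat => (nreduced n)%:R)
                (fun n : nat => A * ((8 + 4 * Num.sqrt 3) ^+ n / n%:R ^+ 3)).
Proof.
have s3 : Num.sqrt 3 ^+ 2 = 3 :> R by rewrite sqr_sqrtr.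
have s0 : 0 <= Num.sqrt 3 :> R by exact: sqrtr_ge0.
set mu := 8 + 4 * Num.sqrt 3.
have mu_itv : 14 < mu < 15 by rewrite /mu; apply/andP; split; nra.
have mu_eq : mu ^+ 2 = 16 * (mu - 1) by rewrite /mu; move: s3; lra.
have /andP[mu14 mu15] := mu_itv.
have /andP[lam1 _] := lam_itv _ _ mu_itv.
have [c [c0 cvc]] := scaled_moment_cvg R.
have [K errK] := nreduced_cubed_error _ _ mu_itv mu_eq.
have G := cubed_moment_cvg _ _ _ lam1 cvc.
set lam := (mu - 1) / (mu - 2) in lam1 errK G.
set g := 1 + _ in errK.
have g0 : 0 < g by rewrite /g addr_gt0 // invr_gt0 mulr_gt0; lra.
pose A := g * (c / lam ^+ 3).
have A0 : 0 < A by rewrite mulr_gt0 ?divr_gt0 ?exprn_gt0 //; lra.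
exists A; split=> //; rewrite /asymp_equiv.
pose v n := catalan_moment R (Num.truncn (lam * n%:R)).
pose err n : R := n%:R ^+ 3 * ((nreduced n)%:R / mu ^+ n - g * v n).
have err0 : err n @[n --> \oo] --> (0 : R).
  apply: norm_cvg0; apply: (@squeeze_cvgr _ _ _ _ (fun=> 0) (fun n => K * n.+1%:R^-1)).
  - near=> n; rewrite normr_ge0 /= normrM (ger0_norm (exprn_ge0 _ _)) //.
    by apply: errK; near: n; exact: nbhs_infty_gt.
  - exact: cvg_cst.
  - by rewrite -[X in _ --> X](mulr0 K); apply: cvgM; [exact: cvg_cst|exact: cvg_harmonic].
have cvF : err n + g * (n%:R ^+ 3 * v n) @[n --> \oo] --> A.
  rewrite -[A]add0r; by apply: cvgD => //; apply: cvgM => //; exact: cvg_cst.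
have An0 : A != 0 by rewrite gt_eqF.
rewrite -(mulfV An0).
apply: (cvg_trans _ (cvgM cvF (cvg_cst A^-1))); apply: near_eq_cvg; near=> n.
have n0 : 0 < n%:R :> R by rewrite ltr0n; near: n; exact: nbhs_infty_gt.
have mun0 : mu ^+ n != 0 by rewrite expf_neq0 //; lra.
rewrite /err /=; field.
by rewrite An0 mun0 gt_eqF.
Unshelve. all: by end_near. Qed.
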